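(* Let $(\mathcal{G},p)$ be an infinitesimally rigid framework in $\mathbb{R}^3$ with $\mathcal{G}=(\mathcal{V},\mathcal{E})$, $\mathcal{V}=\{1,\dots,n\}$ and (fixed) positions $p_1,\dots,p_n\in\mathbb{R}^3$. Let $i_c\in\mathcal{V}$ and let $\iota,\kappa\in\mathcal{V}$ be two neighbors of $i_c$ such that $p_{i_c},p_\iota,p_\kappa$ are not collinear. Put $p_c=p_{i_c}$, $\ell_{ij}=\|p_j-p_i\|$ for $\{i,j\}\in\mathcal{E}$, and for $\hat p=(\hat p_{1,c},\dots,\hat p_{n,c})\in(\mathbb{R}^3)^n$ define $$e(\hat p)=\frac14\sum_{\{i,j\}\in\mathcal{E}}\bigl(\|\hat p_{j,c}-\hat p_{i,c}\|^2-\ell_{ij}^2\bigr)^2+\frac12\|\hat p_{i_c,c}\|^2+\frac12\|\hat p_{\iota,c}-(p_\iota-p_{i_c})\|^2+\frac12\|\hat p_{\kappa,c}-(p_\kappa-p_{i_c})\|^2 .$$ Then the vector of true values $p^\ast=(p_1-p_c,\dots,p_n-p_c)$ is an isolated local minimizer of $e$. Therefore, there exists $\epsilon>0$ such that for every initial condition $\hat p(0)$ with $\|\hat p(0)-p^\ast\|<\epsilon$, the solution $\hat p(t)$ of the gradient flow $\dot{\hat p}=-\nabla e(\hat p)$ converges to $p^\ast$ as $t\to\infty$.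
   Context: A framework in $\mathbb{R}^3$ is a pair $(\mathcal{G},p)$ with $\mathcal{G}=(\mathcal{V},\mathcal{E})$ a finite simple undirected graph and $p:\mathcal{V}\to\mathbb{R}^3$, $p_i=p(i)$. It is infinitesimally rigid if every assignment of velocities $\xi:\mathcal{V}\to\mathbb{R}^3$ with $(\xi(u)-\xi(v))^T(p(u)-p(v))=0$ for all $\{u,v\}\in\mathcal{E}$ is trivial, i.e. is the velocity field of a global rotation and translation: there are $\omega,c\in\mathbb{R}^3$ with $\xi(u)=\omega\times p(u)+c$ for all $u\in\mathcal{V}$. Vertices $i,j$ are neighbors if $\{i,j\}\in\mathcal{E}$. $\|\cdot\|$ is the Euclidean norm. *)

(* Defs.v *)
From HB Require Import structures.
From mathcomp Require Export all_boot all_order all_algebra.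
From mathcomp Require Export all_classical all_reals all_analysis.
Export Order.TTheory GRing.Theory Num.Theory.
Export numFieldNormedType.Exports.

Set Implicit Arguments.
Unset Strict Implicit.
Unset Printing Implicit Defensive.

Local Open Scope classical_set_scope.
Local Open Scope ring_scope.

(* The library norm on matrices is the sup norm, so the Euclidean norm is
   defined separately; on 'M[R]_(n, 3) it is the norm of (R^3)^n. *)
Definition enorm (R : realType) (m n : nat) (A : 'M[R]_(m, n)) : R :=
  Num.sqrt (\sum_(i < m) \sum_(j < n) A i j ^+ 2).

Definition dotv (R : realType) (n : nat) (u v : 'rV[R]_n) : R :=
  (u *m v^T) 0 0.

(* Indices are added modulo 3 in 'I_3. *)
Definition cross (R : realType) (u v : 'rV[R]_3) : 'rV[R]_3 :=
  \row_(k < 3) (u 0 (k + 1) * v 0 (k + 2) - u 0 (k + 2) * v 0 (k + 1)).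

Definition collinear3 (R : realType) (a b c : 'rV[R]_3) : Prop :=
  exists q d : 'rV[R]_3, d != 0 /\
    exists s t r : R, [/\ a = q + s *: d, b = q + t *: d & c = q + r *: d].

Definition infinitesimally_rigid (R : realType) (n : nat)
    (E : rel 'I_n) (p : 'I_n -> 'rV[R]_3) : Prop :=
  forall xi : 'I_n -> 'rV[R]_3,
    (forall u v : 'I_n, E u v -> dotv (xi u - xi v) (p u - p v) = 0) ->
    exists w c : 'rV[R]_3, forall u : 'I_n, xi u = cross w (p u) + c.

(* Row i of the configuration x is the estimate of vertex i; each undirected
   edge is counted once, as the pair with i < j. *)
Definition energy (R : realType) (n : nat) (E : rel 'I_n)
    (p : 'I_n -> 'rV[R]_3) (ic iota kappa : 'I_n) (x : 'M[R]_(n, 3)) : R :=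
  4%:R^-1 * (\sum_(i < n) \sum_(j < n | (i < j)%N && E i j)
     (enorm (row j x - row i x) ^+ 2 - enorm (p j - p i) ^+ 2) ^+ 2)
  + 2%:R^-1 * enorm (row ic x) ^+ 2
  + 2%:R^-1 * enorm (row iota x - (p iota - p ic)) ^+ 2
  + 2%:R^-1 * enorm (row kappa x - (p kappa - p ic)) ^+ 2.

Definition true_values (R : realType) (n : nat) (p : 'I_n -> 'rV[R]_3)
    (ic : 'I_n) : 'M[R]_(n, 3) :=
  \matrix_(i < n) (p i - p ic).

Definition local_minimizer (R : realType) (V : normedModType R)
    (f : V -> R) (x : V) : Prop :=
  \forall y \near x, f x <= f y.

Definition isolated_local_minimizer (R : realType) (V : normedModType R)
    (f : V -> R) (x : V) : Prop :=
  local_minimizer f x /\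
  (\forall y \near x, local_minimizer f y -> y = x).

Definition gradient (R : realType) (m n : nat) (f : 'M[R]_(m, n) -> R)
    (x : 'M[R]_(m, n)) : 'M[R]_(m, n) :=
  \matrix_(i < m, j < n) 'D_(delta_mx i j) f x.

(* Solution on [0, +oo[ of x' = - grad f (x) starting at x0. The values of phi
   at negative times are irrelevant, so at 0 only continuity from the right is
   required; the equation at 0 (with a right derivative) follows when grad f
   is continuous. *)
Definition gradient_flow_solution (R : realType) (m n : nat)
    (f : 'M[R]_(m, n) -> R) (x0 : 'M[R]_(m, n)) (phi : R -> 'M[R]_(m, n)) :
    Prop :=
  [/\ phi 0 = x0,
      {within `[0, +oo[, continuous phi} &
      forall t : R, 0 < t -> is_derive t 1 phi (- gradient f (phi t))].

(* Main.v *)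
Require Import Defs.
From mathcomp Require Import ring lra.

(* Write x = p* + h. The radial derivative de(p* + h)[h] is at least Q(h) - O(|h|^4), where Q(h) is
   the sum over the edges of ((p_j - p_i).(h_j - h_i))^2 plus the squared norms of h at i_c, iota
   and kappa. If Q(h) = 0 then h is an infinitesimal flex, hence a velocity field w x p + c, and its
   vanishing at three non-collinear points forces w = c = 0. So Q is positive definite, and
   de(p* + h)[h] >= mu |h|^2 for small h. This coercivity excludes other critical points near p*,
   and makes |x - p*|^2 decay exponentially along the gradient flow, which therefore never leaves a
   small ball. Since grad e is Lipschitz on bounded sets, clamping its argument to a box gives a
   bounded, globally Lipschitz field; the Picard solution for that field stays in the ball by the
   same estimate, hence solves the original equation. *)

Set Implicit Arguments.
Unset Strict Implicit.
Unset Printing Implicit Defensive.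

Local Open Scope classical_set_scope.
Local Open Scope ring_scope.

(** * Matrix norms and componentwise derivatives *)

Section MatrixNorm.
Variables (R : realType) (m n : nat).
Implicit Types A B : 'M[R]_(m, n).

Lemma ler_entry_norm A i j : `|A i j| <= `|A|.
Proof.
rewrite [leRHS]/Num.Def.normr/= mx_normrE.
exact: (le_bigmax _ (fun ij : 'I_m * 'I_n => `|A ij.1 ij.2|) (i, j)).
Qed.

Lemma mx_norm_le A (c : R) : 0 <= c ->
  (forall i j, `|A i j| <= c) -> `|A| <= c.
Proof.
move=> c0 Ac; rewrite [leLHS]/Num.Def.normr/= mx_normrE.
by apply: bigmax_le => // -[i j] _; exact: Ac.
Qed.

Lemma enorm_sqr A : enorm A ^+ 2 = \sum_(i < m) \sum_(j < n) A i j ^+ 2.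
Proof.
rewrite sqr_sqrtr//; apply: sumr_ge0 => i _; apply: sumr_ge0 => j _.
exact: sqr_ge0.
Qed.

Lemma enorm_ge0 A : 0 <= enorm A.
Proof. exact: sqrtr_ge0. Qed.

Lemma ler_entry_enorm A i j : `|A i j| <= enorm A.
Proof.
rewrite -sqrtr_sqr ler_wsqrtr// (bigD1 i)//= (bigD1 j)//= -addrA lerDl.
apply: addr_ge0; first by apply: sumr_ge0 => k _; exact: sqr_ge0.
by apply: sumr_ge0 => i' _; apply: sumr_ge0 => k _; exact: sqr_ge0.
Qed.

Lemma ler_norm_enorm A : `|A| <= enorm A.
Proof. by apply: mx_norm_le => [|i j]; [exact: enorm_ge0|exact: ler_entry_enorm]. Qed.

Lemma enorm_sqr_le A : enorm A ^+ 2 <= (m * n)%:R * `|A| ^+ 2.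
Proof.
rewrite enorm_sqr; apply: (@le_trans _ _ (\sum_(i < m) \sum_(j < n) `|A| ^+ 2)).
  apply: ler_sum => i _; apply: ler_sum => j _.
  by rewrite -real_normK ?num_real// lerXn2r ?nnegrE// ler_entry_norm.
by rewrite !sumr_const !card_ord -mulrnA mulr_natl mulnC.
Qed.

End MatrixNorm.

Lemma is_derive_bigsum (R : realType) (V W : normedModType R) (I : Type)
    (r : seq I) (P : pred I) (f : I -> V -> W) (df : I -> W) (x v : V) :
  (forall i, is_derive x v (f i) (df i)) ->
  is_derive x v (fun y => \sum_(i <- r | P i) f i y) (\sum_(i <- r | P i) df i).
Proof.
move=> fdf; elim: r => [|i r IH].
  under eq_fun do rewrite big_nil.
  by rewrite big_nil; exact: is_derive_cst.
rewrite big_cons; under eq_fun do rewrite big_cons.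
by case: (P i) => //; exact: is_deriveD.
Qed.

Lemma is_derive_mxP (R : realType) (V : normedModType R) (m n : nat)
    (M : V -> 'M[R]_(m, n)) (x v : V) (A : 'M[R]_(m, n)) :
  is_derive x v M A <-> forall i j, is_derive x v (fun y => M y i j) (A i j).
Proof.
split=> [MA i j|MA].
  have dM : derivable M x v by [].
  apply: DeriveDef; first by move/derivable_mxP: dM.
  by rewrite -(@derive_val _ _ _ _ _ _ _ MA) derive_mx// mxE.
have dM : derivable M x v by apply/derivable_mxP => i j; case: (MA i j).
apply: DeriveDef => //; rewrite derive_mx//; apply/matrixP => i j.
by rewrite mxE; case: (MA i j).
Qed.

(** * Functions that are Lipschitz on bounded sets *)

(** Unlike global Lipschitz continuity, this property is stable under products, so every polynomial
    map has it. *)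
Definition lipschitz_on_balls (R : realType) (V W : normedModType R) (f : V -> W) :=
  forall r : R, exists2 K : R, 0 <= K &
    forall x y : V, `|x| <= r -> `|y| <= r -> `|f x - f y| <= K * `|x - y|.

Section LipschitzOnBalls.
Variables (R : realType) (V : normedModType R).
Implicit Types f g : V -> R.

Lemma lipschitz_on_balls_cst (c : R) : lipschitz_on_balls (fun _ : V => c).
Proof. by move=> r; exists 0 => // x y _ _; rewrite subrr normr0 mul0r. Qed.

Lemma lipschitz_on_ballsD f g : lipschitz_on_balls f -> lipschitz_on_balls g ->
  lipschitz_on_balls (fun x => f x + g x).
Proof.
move=> fL gL r; have [K K0 fK] := fL r; have [L L0 gL'] := gL r.
exists (K + L) => [|x y xr yr]; first exact: addr_ge0.
rewrite opprD addrACA mulrDl (le_trans (ler_normD _ _))//.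
by apply: lerD; [exact: fK|exact: gL'].
Qed.

Lemma lipschitz_on_ballsM f g : lipschitz_on_balls f -> lipschitz_on_balls g ->
  lipschitz_on_balls (fun x => f x * g x).
Proof.
move=> fL gL r.
(* A ball of negative radius is empty; otherwise it contains 0, and comparison with the value at 0
   bounds both factors. *)
have [r0|r0] := ltP r 0.
  by exists 0 => // x y xr; have := normr_ge0 x; rewrite leNgt (le_lt_trans xr r0).
have [K K0 fK] := fL r; have [L L0 gK] := gL r.
have bound (h : V -> R) (H : R) : 0 <= H ->
    (forall x y : V, `|x| <= r -> `|y| <= r -> `|h x - h y| <= H * `|x - y|) ->
    forall x, `|x| <= r -> `|h x| <= `|h 0| + H * r.
  move=> H0 hH x xr; rewrite -[h x](subrK (h 0)) addrC (le_trans (ler_normD _ _))// lerD2l.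
  by apply: (le_trans (hH _ _ xr _)); rewrite ?normr0// subr0 ler_wpM2l.
have fb := bound _ _ K0 fK; have gb := bound _ _ L0 gK.
exists ((`|f 0| + K * r) * L + K * (`|g 0| + L * r)) => [|x y xr yr].
  by rewrite addr_ge0// mulr_ge0// addr_ge0// mulr_ge0.
have -> : f x * g x - f y * g y = f x * (g x - g y) + (f x - f y) * g y by ring.
rewrite (le_trans (ler_normD _ _))// [leRHS]mulrDl lerD// normrM.
  by rewrite -mulrA; apply: ler_pM => //; [exact: fb|exact: gK].
by rewrite mulrAC; apply: ler_pM => //; [exact: fK|exact: gb].
Qed.

Lemma lipschitz_on_ballsN f : lipschitz_on_balls f ->
  lipschitz_on_balls (fun x => - f x).
Proof.
move=> fL r; have [K K0 fK] := fL r; exists K => // x y xr yr.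
by rewrite -opprD normrN; exact: fK.
Qed.

Lemma lipschitz_on_ballsB f g : lipschitz_on_balls f -> lipschitz_on_balls g ->
  lipschitz_on_balls (fun x => f x - g x).
Proof. by move=> fL gL; apply: lipschitz_on_ballsD => //; exact: lipschitz_on_ballsN. Qed.

Lemma lipschitz_on_balls_sum (I : Type) (s : seq I) (P : pred I) (f : I -> V -> R) :
  (forall i, lipschitz_on_balls (f i)) ->
  lipschitz_on_balls (fun x => \sum_(i <- s | P i) f i x).
Proof.
move=> fL; elim: s => [|i s IH].
  by under eq_fun do rewrite big_nil; exact: lipschitz_on_balls_cst.
under eq_fun do rewrite big_cons.
by case: (P i) => //; exact: lipschitz_on_ballsD.
Qed.

End LipschitzOnBalls.

Lemma lipschitz_on_balls_coord (R : realType) m n (i : 'I_m) (j : 'I_n) :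
  lipschitz_on_balls (fun x : 'M[R]_(m, n) => x i j).
Proof.
move=> r; exists 1 => // x y _ _; rewrite mul1r.
by have := ler_entry_norm (x - y) i j; rewrite !mxE.
Qed.

Lemma lipschitz_on_balls_mx (R : realType) (V : normedModType R) m n
    (G : V -> 'M[R]_(m, n)) :
  (forall i j, lipschitz_on_balls (fun x => G x i j)) -> lipschitz_on_balls G.
Proof.
move=> GL r.
have /choice[K KP] : forall ij : 'I_m * 'I_n, exists K : R, 0 <= K /\
    forall x y : V, `|x| <= r -> `|y| <= r ->
    `|G x ij.1 ij.2 - G y ij.1 ij.2| <= K * `|x - y|.
  by move=> ij; have [K K0 KP] := GL ij.1 ij.2 r; exists K.
have K0 ij : 0 <= K ij by have [] := KP ij.
exists (\sum_ij K ij) => [|x y xr yr]; first exact: sumr_ge0.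
apply: mx_norm_le => [|i j]; first by rewrite mulr_ge0// sumr_ge0.
rewrite !mxE; apply: (le_trans ((KP (i, j)).2 _ _ xr yr)).
by rewrite ler_wpM2r// (bigD1 (i, j))//= lerDl sumr_ge0.
Qed.

Lemma lipschitz_on_balls_continuous (R : realType) (V W : normedModType R)
    (f : V -> W) : lipschitz_on_balls f -> continuous f.
Proof.
move=> fL x; have [K K0 fK] := fL (`|x| + 1).
apply/cvgrPdist_lt => e e0.
(* [K + 1] rather than [K] keeps the denominator positive when [K] is 0. *)
have d0 : 0 < e / (K + 1) by rewrite divr_gt0// ltr_wpDl.
have xx : x @[x --> x] --> x by exact: cvg_id.
move/cvgrPdist_lt : xx => xx.
apply: filterS2 (xx _ ltr01) (xx _ d0) => y y1 yd.
have yx : `|y| <= `|x| + 1.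
  rewrite -[y](subrKC x) (le_trans (ler_normD _ _))// lerD2l distrC; exact: ltW.
apply: (le_lt_trans (fK _ _ _ yx)); first by rewrite lerDl.
apply: (@le_lt_trans _ _ ((K + 1) * `|x - y|)); first by rewrite ler_wpM2r// lerDl.
by rewrite mulrC -ltr_pdivlMr// ltr_wpDl.
Qed.

Lemma lipschitz_on_ballsX (R : realType) (V : normedModType R) (f : V -> R) n :
  lipschitz_on_balls f -> lipschitz_on_balls (fun x => f x ^+ n).
Proof.
move=> fL; elim: n => [|n IH].
  by under eq_fun do rewrite expr0; exact: lipschitz_on_balls_cst.
by under eq_fun do rewrite exprS; exact: lipschitz_on_ballsM.
Qed.

Lemma lipschitz_continuous (R : realType) (V W : normedModType R) (f : V -> W)
    (K : R) :
  (forall x y, `|f x - f y| <= K * `|x - y|) -> continuous f.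
Proof.
move=> fK; apply: lipschitz_on_balls_continuous => r.
exists `|K| => // x y _ _; apply: (le_trans (fK x y)).
by rewrite ler_wpM2r// ler_norm.
Qed.

Lemma lipschitz_extension (R : realType) m n (W : normedModType R)
    (G : 'M[R]_(m, n) -> W) (r : R) :
  0 <= r -> lipschitz_on_balls G ->
  exists H : 'M[R]_(m, n) -> W, exists L M : R,
    [/\ 0 < L, forall x y, `|H x - H y| <= L * `|x - y|, forall x, `|H x| <= M
      & forall x, `|x| <= r -> H x = G x].
Proof.
move=> r0 GL; have [K K0 GK] := GL r.
pose c (a : R) := Num.max (- r) (Num.min r a).
have cP a : [\/ a <= - r /\ c a = - r, - r <= a <= r /\ c a = a | r <= a /\ c a = r].
  rewrite /c; have [ar|/ltW ra] := leP r a; last first.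
    by have [ra'|/ltW ra'] := leP a (- r); [apply: Or31|apply: Or32; rewrite ra'].
  by apply: Or33; split=> //; apply: max_r; lra.
have c_lip a b : `|c a - c b| <= `|a - b|.
  rewrite ler_norml; have := ler_norm (a - b); have := ler_norm (- (a - b)).
  rewrite normrN.
  by case: (cP a) => -[? ->]; case: (cP b) => -[? ->] ? ?; apply/andP; split; lra.
have c_le a : `|c a| <= r.
  by rewrite ler_norml; case: (cP a) => -[? ->]; apply/andP; split; lra.
have c_id a : `|a| <= r -> c a = a.
  by rewrite ler_norml /c => /andP[ra ar]; rewrite min_r// max_r.
(* Clamping every entry to [-r, r] is 1-Lipschitz in the sup norm. *)
pose cl (A : 'M[R]_(m, n)) := map_mx c A.
have cl_le A : `|cl A| <= r by apply: mx_norm_le => // i j; rewrite mxE.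
have cl_lip A B : `|cl A - cl B| <= `|A - B|.
  apply: mx_norm_le => // i j; rewrite !mxE; apply: le_trans (c_lip _ _) _.
  by have := ler_entry_norm (A - B) i j; rewrite !mxE.
have HL x y : `|G (cl x) - G (cl y)| <= (K + 1) * `|x - y|.
  apply: (le_trans (GK _ _ (cl_le x) (cl_le y))).
  by apply: ler_pM => //; rewrite lerDl.
(* The [+ 1] makes the Lipschitz constant positive even when [K = 0]; [r + r] bounds the distance
   between two clamped points. *)
exists (G \o cl), (K + 1), (`|G (cl 0)| + (K + 1) * (r + r)); split=> //.
- by rewrite ltr_wpDl.
- move=> x /=; rewrite -[G (cl x)](subrK (G (cl 0))) addrC.
  rewrite (le_trans (ler_normD _ _))// lerD2l (le_trans (GK _ _ (cl_le _) (cl_le _)))//.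
  apply: ler_pM => //; first by rewrite lerDl.
  by rewrite (le_trans (ler_normB _ _))// lerD.
- move=> x xr /=; congr G; apply/matrixP => i j; rewrite mxE c_id//.
  exact: le_trans (ler_entry_norm _ _ _) xr.
Qed.

(** * Global solutions of Lipschitz differential equations *)

(* Integrating from -1 makes the derivative at 0 two-sided. *)
Lemma antiderivative_exists (R : realType) (g : R -> R) : continuous g ->
  exists F : R -> R, F 0 = 0 /\ forall t : R, 0 <= t -> is_derive t 1 F (g t).
Proof.
move=> cg; pose mu := @lebesgue_measure R.
pose F0 (x : R) : R := (\int[mu]_(t in [set` `[-1, x]]) g t)%R.
exists (fun t => F0 t - F0 0); split=> [|t t0]; first by rewrite subrr.
have t1 : t < t + 1 by rewrite ltrDl.
have [||d1 d2] := @continuous_FTC1_closed R g (-1) t (t + 1) t1 _ _ (cg t).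
- apply: continuous_compact_integrable; first exact: segment_compact.
  exact: continuous_subspaceT.
- lra.
have -> : g t = g t - 0 by rewrite subr0.
apply: is_deriveB.
by apply: DeriveDef => //; rewrite -derive1E.
Qed.

Lemma antiderivative_mx_exists (R : realType) m n (g : R -> 'M[R]_(m, n)) :
  continuous g ->
  exists F : R -> 'M[R]_(m, n),
    F 0 = 0 /\ forall t : R, 0 <= t -> is_derive t 1 F (g t).
Proof.
move=> cg.
have cgij (ij : 'I_m * 'I_n) : continuous (fun t => g t ij.1 ij.2).
  move=> t; apply: (@continuous_comp _ _ _ g (fun A : 'M[R]_(m, n) => A ij.1 ij.2)).
    exact: cg.
  exact: coord_continuous.
have [F FP] := choice (fun ij => antiderivative_exists (cgij ij)).
exists (fun t => \matrix_(i, j) F (i, j) t); split.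
  by apply/matrixP => i j; rewrite !mxE; case: (FP (i, j)).
move=> t t0; apply/is_derive_mxP => i j; under eq_fun do rewrite mxE.
by case: (FP (i, j)) => _ /(_ t t0).
Qed.

(** * Growth bounds from derivative bounds *)

Lemma is_derive_expRM (R : realType) (a t : R) :
  is_derive t 1 (fun s => expR (a * s)) (a * expR (a * t)).
Proof.
have d1 : is_derive t 1 (fun s : R => a * s) a.
  have := @is_deriveZ R R^o R^o id a t 1 1 _.
  by rewrite [_ *: _]mulr1; apply; exact: is_derive_id.
have d2 := is_derive_expR (a * t).
have := is_derive1_comp d2 d1; rewrite mulrC.
exact.
Qed.

Lemma is_derive_continuous (R : realType) (V : normedModType R) (f : R -> V)
  (t : R) (l : V) : is_derive t 1 f l -> {for t, continuous f}.
Proof. by move=> fl; apply/differentiable_continuous/derivable1_diffP. Qed.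

Lemma derivable_nonneg_within_continuous (R : realType) (V : normedModType R)
    (f : R -> V) (g : R -> V) (t : R) :
  (forall s : R, 0 <= s -> is_derive s 1 f (g s)) ->
  {within `[0, t], continuous f}.
Proof.
move=> df; apply: continuous_in_subspaceT => s.
rewrite inE/= in_itv/= => /andP[s0 _].
by apply: is_derive_continuous; exact: df.
Qed.

(** [C / a * (expR (a * t) - 1)] is the antiderivative of the bound that vanishes at 0, so its
    difference with [f] is nondecreasing. *)
Lemma le_exp_of_derive (R : realType) (f g : R -> R) (a C t : R) :
  0 < a -> 0 <= t -> f 0 = 0 ->
  (forall s : R, 0 <= s -> is_derive s 1 f (g s)) ->
  (forall s : R, 0 <= s -> g s <= C * expR (a * s)) ->
  f t <= C / a * (expR (a * t) - 1).
Proof.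
move=> a0 t0 f0 df gC.
pose h s := C / a * expR (a * s) - f s.
have dh (s : R) : 0 <= s -> is_derive s 1 h (C * expR (a * s) - g s).
  move=> s0; apply: is_deriveB; last exact: df.
  have -> : C * expR (a * s) = C / a *: (a * expR (a * s)).
    by rewrite /GRing.scale/= mulrA divfK// gt_eqF.
  by apply: is_deriveZ; exact: is_derive_expRM.
have : h 0 <= h t.
  apply: (@ger0_derive1_le_cc R h 0 t) => //.
  - by move=> s; rewrite in_itv/= => /andP[/ltW s0 _]; apply: ex_derive; exact: dh.
  - move=> s; rewrite in_itv/= => /andP[/ltW s0 _].
    by rewrite derive1E (@derive_val _ _ _ _ _ _ _ (dh _ s0)) subr_ge0; exact: gC.
  - exact: derivable_nonneg_within_continuous dh.
  - by rewrite in_itv/= lexx.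
  - by rewrite in_itv/= lexx t0.
by rewrite /h f0 mulr0 expR0; lra.
Qed.

(** In the sup norm it suffices to bound each entry and its negative. Dropping the [- 1] gives a
    bound of the same shape as the hypothesis, with [C] replaced by [C / a], so that it can be
    iterated. *)
Lemma norm_le_exp_of_derive (R : realType) m n (f g : R -> 'M[R]_(m, n))
    (a C t : R) :
  0 < a -> 0 <= C -> 0 <= t -> f 0 = 0 ->
  (forall s : R, 0 <= s -> is_derive s 1 f (g s)) ->
  (forall s : R, 0 <= s -> `|g s| <= C * expR (a * s)) ->
  `|f t| <= C / a * expR (a * t).
Proof.
move=> a0 C0 t0 f0 df gC.
have Ca : 0 <= C / a by rewrite divr_ge0// ltW.
apply: mx_norm_le => [|i j]; first by rewrite mulr_ge0// expR_ge0.
have dfij (s : R) : 0 <= s -> is_derive s 1 (fun u => f u i j) (g s i j).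
  by move=> /df /is_derive_mxP.
have gij (s : R) : 0 <= s -> `|g s i j| <= C * expR (a * s).
  by move=> s0; apply: le_trans (gC _ s0); exact: ler_entry_norm.
apply: (@le_trans _ _ (C / a * (expR (a * t) - 1))); last first.
  by rewrite ler_wpM2l// gerBl.
rewrite ler_norml; apply/andP; split.
  rewrite lerNl.
  apply: (@le_exp_of_derive _ (fun s => - f s i j) (fun s => - g s i j)) => //.
  - by rewrite f0 mxE oppr0.
  - by move=> s s0; apply: is_deriveN; exact: dfij.
  - by move=> s s0; apply: le_trans (gij _ s0); rewrite -normrN ler_norm.
apply: (@le_exp_of_derive _ (fun s => f s i j) (fun s => g s i j)) => //.
- by rewrite f0 mxE.
- by move=> s s0; apply: le_trans (gij _ s0); rewrite ler_norm.
Qed.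

(** The equality form of the mean value theorem fails for vector-valued maps, but in the sup norm it
    is enough to apply it to each entry, with an intermediate point of its own. *)
Lemma norm_increment_le (R : realType) m n (f g : R -> 'M[R]_(m, n))
    (C s t : R) :
  0 <= C -> 0 <= s -> 0 <= t ->
  (forall u : R, 0 <= u -> is_derive u 1 f (g u)) ->
  (forall u : R, 0 <= u -> `|g u| <= C) ->
  `|f t - f s| <= C * `|t - s|.
Proof.
move=> C0 s0 t0 df gC.
wlog st : s t s0 t0 / s <= t.
  move=> H; have [st|/ltW ts] := leP s t; first exact: H.
  by rewrite distrC (distrC t); exact: H.
apply: mx_norm_le => [|i j]; first by rewrite mulr_ge0.
have [||c cst] := @MVT_segment R (fun u => f u i j) (fun u => g u i j) s t st.
- move=> u; rewrite in_itv/= => /andP[su _].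
  by have /is_derive_mxP := df _ (le_trans s0 (ltW su)).
- apply: continuous_in_subspaceT => u; rewrite inE/= in_itv/= => /andP[su _].
  have /is_derive_mxP/(_ i j) := df _ (le_trans s0 su).
  exact: is_derive_continuous.
rewrite !mxE => ->; rewrite normrM ler_wpM2r//.
apply: le_trans (ler_entry_norm _ _ _) (gC _ _).
by move: cst; rewrite in_itv/= => /andP[sc _]; exact: le_trans sc.
Qed.

(** The intervals of centre [u k] and radius [2 * C / 2 ^+ k] are nested, because the radius drops
    by exactly [C / 2 ^+ k] at each step. The supremum of their left ends lies in all of them. *)
Lemma geometric_cvg (R : realType) (u : nat -> R) (C : R) :
  (forall k, `|u k.+1 - u k| <= C / 2 ^+ k) ->
  exists l, forall k, `|u k - l| <= 2 * C / 2 ^+ k.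
Proof.
move=> uC.
pose r k : R := 2 * C / 2 ^+ k.
have rS k : r k.+1 = C / 2 ^+ k.
  by rewrite /r exprS; have : (2 : R) ^+ k != 0 by []; move: (2 ^+ k) => q q0; field.
have rk k : r k = 2 * r k.+1 by rewrite rS /r mulrA.
have lo k : u k - r k <= u k.+1 - r k.+1.
  by have := uC k; rewrite -rS ler_norml (rk k) => /andP[]; lra.
have hi k : u k.+1 + r k.+1 <= u k + r k.
  by have := uC k; rewrite -rS ler_norml (rk k) => /andP[]; lra.
have r0 k : 0 <= r k.
  have C0 : 0 <= C by have := le_trans (normr_ge0 _) (uC 0); rewrite expr0 divr1.
  by rewrite divr_ge0// mulr_ge0.
have mlo : {homo (fun k => u k - r k) : j k / (j <= k)%N >-> j <= k}.
  by apply: homo_leq => // y x z; exact: le_trans.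
have mhi : {homo (fun k => u k + r k) : j k / (j <= k)%N >-> k <= j}.
  by apply: homo_leq => // y x z xy yz; exact: le_trans yz xy.
have lohi j k : u j - r j <= u k + r k.
  apply: (le_trans (mlo _ _ (leq_maxl j k))).
  apply: le_trans (mhi _ _ (leq_maxr j k)).
  by have := r0 (maxn j k); lra.
exists (sup (range (fun k => u k - r k))) => k.
rewrite distrC ler_distl; apply/andP; split.
  apply: ub_le_sup; last by exists k.
  by exists (u 0 + r 0) => _ [j _ <-]; exact: lohi.
apply: ge_sup; first by exists (u 0 - r 0), 0%N.
by move=> _ [j _ <-]; exact: lohi.
Qed.

Lemma le_of_geometric (R : realType) (x y K : R) :
  (forall k : nat, x <= y + K / 2 ^+ k) -> x <= y.
Proof.
move=> H; apply/ler_addgt0Pr => e e0.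
have [K0|K0] := leP K 0.
  by apply: (le_trans (H 0)); rewrite expr0 divr1 lerD2l (le_trans K0)// ltW.
(* With [k] the integer part of [K / e], one has [K / e < k + 1 <= 2 ^ k]. *)
apply: (le_trans (H (Num.truncn (K / e)))); rewrite lerD2l.
rewrite ler_pdivrMr ?exprn_gt0// mulrC -ler_pdivrMr//.
have Ke : 0 <= K / e by rewrite divr_ge0// ltW.
apply/ltW/(lt_le_trans (truncnS_gt _)).
by rewrite -natrX ler_nat ltn_expl.
Qed.

(* Picard iteration. The absolute value extends the iterates to negative times, so that they are
   globally Lipschitz; in the weight exp(2Lt) the iteration contracts by 1/2. *)
Theorem picard_lindelof (R : realType) m n (G : 'M[R]_(m, n) -> 'M[R]_(m, n))
    (L M : R) (x0 : 'M[R]_(m, n)) :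
  0 < L -> (forall x y, `|G x - G y| <= L * `|x - y|) ->
  (forall x, `|G x| <= M) ->
  exists phi : R -> 'M[R]_(m, n),
    phi 0 = x0 /\ forall t : R, 0 <= t -> is_derive t 1 phi (G (phi t)).
Proof.
move=> L0 GL GM.
have M0 : 0 <= M := le_trans (normr_ge0 _) (GM 0).
have a0 : 0 < 2 * L by rewrite mulr_gt0.
pose lip (psi : R -> 'M[R]_(m, n)) := forall s t, `|psi s - psi t| <= M * `|s - t|.
have Gcont psi : lip psi -> continuous (G \o psi).
  move=> psiM; apply: (@lipschitz_continuous _ _ _ _ (L * M)) => s t.
  by apply: (le_trans (GL _ _)); rewrite -mulrA ler_wpM2l// ltW.
(* [A] chooses an antiderivative of [G \o psi] vanishing at 0; on paths that are not [lip] its value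
   is arbitrary. *)
have /choice[A AP] : forall psi, exists F : R -> 'M[R]_(m, n), lip psi ->
    F 0 = 0 /\ forall t : R, 0 <= t -> is_derive t 1 F (G (psi t)).
  move=> psi; have [psiM|psiM] := pselect (lip psi); last by exists psi.
  by have [F FP] := antiderivative_mx_exists (Gcont _ psiM); exists F.
pose T psi := fun t : R => x0 + A psi `|t|.
have Tlip psi : lip psi -> lip (T psi).
  move=> psiM s t; have [_ dA] := AP _ psiM.
  rewrite /T opprD addrACA subrr add0r.
  apply: (le_trans (norm_increment_le (C := M) _ _ _ dA _)) => //.
  by rewrite ler_wpM2l// ler_dist_dist.
have Tcontr psi1 psi2 C : lip psi1 -> lip psi2 -> 0 <= C ->
    (forall t : R, 0 <= t -> `|psi1 t - psi2 t| <= C * expR (2 * L * t)) ->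
    forall t : R, 0 <= t -> `|A psi1 t - A psi2 t| <= C / 2 * expR (2 * L * t).
  move=> lip1 lip2 C0 dist t t0.
  have [A10 dA1] := AP _ lip1; have [A20 dA2] := AP _ lip2.
  (* Integration in the weight exp(2Lt) divides the Lipschitz constant [L] by the rate [2 * L]: the
     source of the factor 1/2. *)
  have -> : C / 2 = L * C / (2 * L) by field; rewrite gt_eqF.
  apply: (@norm_le_exp_of_derive _ _ _ (A psi1 - A psi2)
    (fun s => G (psi1 s) - G (psi2 s))) => //.
  - by rewrite mulr_ge0// ltW.
  - by rewrite -[LHS]/(A psi1 0 - A psi2 0) A10 A20 subrr.
  - by move=> s s0; apply: is_deriveB; [exact: dA1|exact: dA2].
  - move=> s s0; apply: (le_trans (GL _ _)); rewrite -mulrA ler_wpM2l//; first exact: ltW.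
    exact: dist.
pose psi k := iter k T (fun=> x0).
have psi_lip k : lip (psi k).
  by elim: k => [|k IH]; [move=> s t; rewrite subrr normr0 mulr_ge0|exact: Tlip].
(* [C] bounds the first step: the derivative has norm at most [M <= M exp(2Ls)], and integration
   divides by [2 * L]. *)
pose C := M / (2 * L).
have C0 : 0 <= C by rewrite divr_ge0// ltW.
have psi_step k (t : R) : `|psi k.+1 t - psi k t| <= C * expR (2 * L * `|t|) / 2 ^+ k.
  elim: k t => [|k IH] t.
    rewrite expr0 divr1 /= /T addrC addKr.
    have [A0 dA] := AP _ (psi_lip 0).
    apply: (norm_le_exp_of_derive _ _ _ A0 dA) => // s s0.
    apply: (le_trans (GM _)); rewrite ler_peMr//.
    by rewrite -[leLHS]expR0 ler_expR mulr_ge0// ltW.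
  rewrite /= /T opprD addrACA subrr add0r.
  apply: (le_trans (Tcontr _ _ (C / 2 ^+ k) _ _ _ _ _ _)) => //.
  - exact: (psi_lip k.+1).
  - by rewrite divr_ge0.
  - by move=> s s0; apply: (le_trans (IH s)); rewrite ger0_norm// mulrAC.
  - have -> : C * expR (2 * L * `|t|) / 2 ^+ k.+1 = C / 2 ^+ k / 2 * expR (2 * L * `|t|).
      by rewrite exprSr invfM !mulrA; ring.
    exact: lexx.
have /choice[l lP] : forall t : R, exists l : 'M[R]_(m, n), forall k,
    `|psi k t - l| <= 2 * (C * expR (2 * L * `|t|)) / 2 ^+ k.
  move=> t.
  have /choice[l lP] : forall ij : 'I_m * 'I_n, exists l, forall k,
      `|psi k t ij.1 ij.2 - l| <= 2 * (C * expR (2 * L * `|t|)) / 2 ^+ k.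
    move=> ij; apply: geometric_cvg => k; apply: le_trans (psi_step k t).
    by have := ler_entry_norm (psi k.+1 t - psi k t) ij.1 ij.2; rewrite !mxE.
  exists (\matrix_(i, j) l (i, j)) => k; apply: mx_norm_le => [|i j].
    by rewrite divr_ge0// mulr_ge0// mulr_ge0// expR_ge0.
  by rewrite !mxE; exact: (lP (i, j) k).
(* The limit has to be [lip] for [A l] to be meaningful; the bound passes to the limit through
   [psi k]. *)
have l_lip : lip l.
  move=> s t; apply: (@le_of_geometric _ _ _
    (2 * (C * expR (2 * L * `|s|)) + 2 * (C * expR (2 * L * `|t|)))) => k.
  have -> : l s - l t = (psi k s - psi k t) - (psi k s - l s) + (psi k t - l t).
    by apply/matrixP => i j; rewrite !mxE; ring.
  rewrite (mulrDl (2 * _)) [leRHS]addrA; apply: (le_trans (ler_normD _ _)).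
  apply: lerD; last exact: lP.
  by apply: (le_trans (ler_normB _ _)); apply: lerD; [exact: psi_lip|exact: lP].
have [Al0 dAl] := AP _ l_lip.
(* Both sides are within a multiple of [2^-k] of [psi k.+1 t], since that iterate is
   [x0 + A (psi k) t] and [A] contracts. *)
have fix_l (t : R) : 0 <= t -> x0 + A l t = l t.
  move=> t0; apply/eqP; rewrite -subr_eq0 -normr_le0.
  apply: (@le_of_geometric _ _ _ (2 * (C * expR (2 * L * t)))) => k.
  rewrite add0r.
  have -> : x0 + A l t - l t = (psi k.+1 t - l t) - (A (psi k) t - A l t).
    by rewrite /= /T ger0_norm//; apply/matrixP => i j; rewrite !mxE; ring.
  apply: (le_trans (ler_normB _ _)).
  have := lP t k.+1; rewrite (ger0_norm t0) => h1.
  have h2 := Tcontr _ _ (2 * C / 2 ^+ k) (psi_lip k) l_lip _ _ t t0.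
  apply: (le_trans (lerD h1 (h2 _ _))).
  - by rewrite divr_ge0// mulr_ge0.
  - by move=> s s0; apply: (le_trans (lP s k)); rewrite ger0_norm// !mulrA mulrAC.
  - rewrite exprS; have : (2 : R) ^+ k != 0 by [].
    by move: (2 ^+ k) (expR _) => q e q0; rewrite le_eqVlt; apply/orP; left; apply/eqP; field.
(* The limit [l] is even in time, so it may have a corner at 0; [x0 + A l] agrees with it for
   [t >= 0] and is differentiable at 0 as well. *)
exists (fun t => x0 + A l t); split=> [|t t0]; first by rewrite Al0 addr0.
rewrite fix_l// -[G (l t)]add0r.
by apply: is_deriveD; exact: dAl.
Qed.

(** * Gradient flows near a radially coercive point *)

(** A bootstrap argument: while [f < c], the product of [f] with exp(mu t) is nonincreasing, so [f]
    is at most [f 0], strictly below [c], and never reaches [c]. *)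
Lemma exp_decay_below (R : realType) (f g : R -> R) (mu c : R) :
  0 <= mu -> {within `[0, +oo[, continuous f} ->
  (forall t : R, 0 < t -> is_derive t 1 f (g t)) ->
  (forall t : R, 0 < t -> f t < c -> g t <= - mu * f t) ->
  0 <= f 0 -> f 0 < c ->
  forall t : R, 0 <= t -> f t < c /\ f t <= f 0 * expR (- mu * t).
Proof.
move=> mu0 cf df gf f0 f0c.
have decay (t : R) : 0 <= t -> (forall s : R, 0 < s -> s < t -> f s < c) ->
    f t <= f 0 * expR (- mu * t).
  move=> t0 fc.
  pose h s := f s * expR (mu * s).
  have dh (s : R) : 0 < s -> is_derive s 1 h (expR (mu * s) * (g s + mu * f s)).
    move=> s0; apply: (is_derive_eq (is_deriveM (df s s0) (is_derive_expRM mu s))).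
    by rewrite /GRing.scale/=; ring.
  have : h t <= h 0.
    apply: (@ler0_derive1_le_cc R h 0 t) => //.
    - by move=> s; rewrite in_itv/= => /andP[s0 _]; apply: ex_derive; exact: dh.
    - move=> s; rewrite in_itv/= => /andP[s0 st].
      rewrite derive1E (@derive_val _ _ _ _ _ _ _ (dh _ s0)).
      rewrite pmulr_rle0 ?expR_gt0//.
      by have := gf _ s0 (fc _ s0 st); lra.
    - have sub : `[0, t]%classic `<=` `[0, +oo[%classic.
        by move=> s /=; rewrite !in_itv/= => /andP[-> _].
      have cft := continuous_subspaceW sub cf.
      have ce : {within `[0, t], continuous (fun s => expR (mu * s))}.
        apply: continuous_subspaceT => s; exact: is_derive_continuous (is_derive_expRM mu s).
      by move=> s; exact: (cvgM (cft s) (ce s)).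
    - by rewrite in_itv/= lexx t0.
    - by rewrite in_itv/= lexx t0.
  rewrite /h mulr0 expR0 mulr1 => ht.
  by rewrite mulNr expRN ler_pdivlMr// expR_gt0.
have bound (t : R) : 0 <= t -> f 0 * expR (- mu * t) < c.
  move=> t0; apply: le_lt_trans f0c; rewrite ler_piMr//.
  by rewrite -[leRHS]expR0 ler_expR mulNr oppr_le0 mulr_ge0.
suff below (t : R) : 0 <= t -> f t < c.
  by move=> t t0; split; [exact: below|apply: decay => // s s0 _; apply: below; exact: ltW].
move=> t0; rewrite ltNge; apply/negP => cft.
(* [inf S] is the first exit time. Decay up to it gives [f (inf S) < c], and continuity keeps
   [f < c] shortly after, so points of [S] cannot accumulate at [inf S]. *)
pose S := [set s | 0 <= s /\ c <= f s].
have S0 : has_inf S by split; [exists t|exists 0 => s []].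
have tau0 : 0 <= inf S by apply: lb_le_inf; [exists t|move=> s []].
have before (s : R) : 0 <= s -> s < inf S -> f s < c.
  move=> s0 st; rewrite ltNge; apply/negP => cfs.
  have : inf S <= s by apply: ge_inf; [exists 0 => ? []|].
  by rewrite leNgt st.
have ftau : f (inf S) < c.
  apply: (le_lt_trans _ (bound _ tau0)); apply: decay => // s s0.
  by apply: before; exact: ltW.
have /subspace_continuousP/(_ (inf S)) := cf.
rewrite /= in_itv/= tau0 => /(_ isT) ctau.
have : \forall s \near within `[0, +oo[%classic (nbhs (inf S)), f s < c.
  exact: (cvgr_lt _ ctau _ ftau).
rewrite near_withinE => /nbhs_ballP[d /= d0 near_tau].
have [s [s0 cs] sd] := inf_adherent d0 S0.
have : f s < c.
  apply: near_tau => /=; last by rewrite in_itv/= s0.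
  have ts : inf S <= s by apply: ge_inf; [exists 0 => ? []|].
  by rewrite /ball/= distrC ger0_norm ?subr_ge0// ltrBlDl.
by rewrite ltNge cs.
Qed.

(** The two difference quotients are the same function of the increment. *)
Lemma is_derive_line (R : realType) (V W : normedModType R) (f : V -> W)
    (x v : V) (s : R) (l : W) :
  is_derive (s *: v + x) v f l -> is_derive s 1 (fun u : R => f (u *: v + x)) l.
Proof.
have E : (fun h : R => h^-1 *: (((fun u : R => f (u *: v + x)) \o shift s) (h *: 1)
             - f (s *: v + x))) =
    (fun h : R => h^-1 *: ((f \o shift (s *: v + x)) (h *: v) - f (s *: v + x))).
  apply/funext => h /=; congr (_ *: (f _ - _)).
  by rewrite [h *: 1]mulr1 scalerDl addrA.
move=> [d1 d2]; apply: DeriveDef.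
  by rewrite /derivable E.
by rewrite /derive E.
Qed.

Lemma local_minimizer_derive (R : realType) (V : normedModType R) (f : V -> R)
    (df : V -> V -> R) (x v : V) :
  (forall y, is_derive y v f (df y v)) -> local_minimizer f x -> df x v = 0.
Proof.
move=> fdf xmin.
pose g (s : R) := f (s *: v + x).
have dg (s : R) : is_derive s 1 g (df (s *: v + x) v).
  by apply: is_derive_line; exact: fdf.
have cont : (fun s : R => s *: v + x) s @[s --> (0 : R)] --> x.
  rewrite -[X in _ --> X](add0r x) -[X in _ --> X + _](scale0r v).
  by apply: cvgD; [apply: cvgZr_tmp; exact: cvg_id|exact: cvg_cst].
have /nbhs_ballP[d /= d0 dmin] : \forall s \near (0 : R), f x <= g s.
  exact: cont xmin.
have : is_derive (0 : R) 1 g 0.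
  apply: (@derive1_at_min _ g (- d) d).
  - lra.
  - by move=> t _; apply: ex_derive; exact: dg.
  - by rewrite in_itv/= oppr_lt0 d0.
  - move=> t; rewrite in_itv/= => td; rewrite {1}/g scale0r add0r; apply: dmin.
    by rewrite /ball/= sub0r normrN ltr_norml.
move=> /@derive_val <-; have := @derive_val _ _ _ _ _ _ _ (dg 0).
by rewrite scale0r add0r.
Qed.

(** The squared distance to [p] is a Lyapunov function; its derivative carries a factor 2, hence the
    rate [2 * mu]. The velocity [F] is kept abstract so that the estimate serves both the gradient
    flow and its clamped version. *)
Lemma lyapunov_exp_decay (R : realType) m n (phi F : R -> 'M[R]_(m, n))
    (p : 'M[R]_(m, n)) (r mu : R) :
  0 < r -> 0 <= mu ->
  {within `[0, +oo[, continuous phi} ->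
  (forall t : R, 0 < t -> is_derive t 1 phi (F t)) ->
  (forall t : R, 0 < t -> enorm (phi t - p) < r ->
    \sum_(i < m) \sum_(j < n) (phi t - p) i j * F t i j
      <= - mu * enorm (phi t - p) ^+ 2) ->
  enorm (phi 0 - p) < r ->
  forall t : R, 0 <= t -> enorm (phi t - p) < r /\
    enorm (phi t - p) ^+ 2 <= r ^+ 2 * expR (- (2 * mu) * t).
Proof.
move=> r0 mu0 cphi dphi decr init t t0.
have sqr_lt (A : 'M[R]_(m, n)) : (enorm A ^+ 2 < r ^+ 2) = (enorm A < r).
  by rewrite ltr_pXn2r ?nnegrE ?enorm_ge0 ?ltW.
pose V (s : R) := enorm (phi s - p) ^+ 2.
pose dV (s : R) := \sum_(i < m) \sum_(j < n) 2 * ((phi s - p) i j * F s i j).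
have VE : V = fun s => \sum_(i < m) \sum_(j < n) (phi s i j - p i j) ^+ 2.
  apply/funext => s; rewrite /V enorm_sqr.
  by apply: eq_bigr => i _; apply: eq_bigr => j _; rewrite !mxE.
have [||||||Vr Vexp] := @exp_decay_below R V dV (2 * mu) (r ^+ 2) _ _ _ _ _ _ t t0.
- by rewrite mulr_ge0.
- rewrite VE => s.
  have cij i j : {within `[0, +oo[, continuous (fun u => phi u i j - p i j)}.
    move=> u; apply: cvgB; last exact: cvg_cst.
    apply: (@cvg_comp _ _ _ phi (fun A : 'M[R]_(m, n) => A i j) _ _ _ (cphi u) _).
    exact: coord_continuous.
  apply: cvg_big => [|i _]; first exact: add_continuous.
  apply: cvg_big => [|j _]; first exact: add_continuous.
  by apply: cvgM; exact: cij.
- move=> s s0; rewrite VE.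
  apply: is_derive_bigsum => i; apply: is_derive_bigsum => j.
  have /is_derive_mxP/(_ i j) dij := dphi _ s0.
  have d1 : is_derive s 1 (fun u => phi u i j - p i j) (F s i j).
    by rewrite -[F s i j]subr0; apply: is_deriveB.
  apply: (is_derive_eq (is_deriveM d1 d1)).
  by rewrite !mxE /GRing.scale/=; ring.
- move=> s s0; rewrite sqr_lt => /(decr _ s0) h.
  have -> : dV s = 2 * \sum_(i < m) \sum_(j < n) (phi s - p) i j * F s i j.
    by rewrite mulr_sumr; apply: eq_bigr => i _; rewrite mulr_sumr.
  by rewrite /V; lra.
- by rewrite /V sqr_ge0.
- by rewrite sqr_lt.
split; first by rewrite -sqr_lt.
apply: (le_trans Vexp); rewrite ler_wpM2r ?expR_ge0//.
by apply: ltW; rewrite sqr_lt.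
Qed.

Section RadiallyCoercive.
Variables (R : realType) (m n : nat) (f : 'M[R]_(m, n) -> R).
Variables (df : 'M[R]_(m, n) -> 'M[R]_(m, n) -> R) (p : 'M[R]_(m, n)) (r mu : R).
Hypotheses (r0 : 0 < r) (mu0 : 0 < mu).
Hypothesis fdf : forall x v, is_derive x v f (df x v).
Hypothesis df_coord : forall x v,
  df x v = \sum_(i < m) \sum_(j < n) v i j * df x (delta_mx i j).
Hypothesis df_lip : forall v, lipschitz_on_balls (df ^~ v).
Hypothesis coercive : forall h, `|h| <= r -> mu * enorm h ^+ 2 <= df (p + h) h.

(** At a local minimizer [y] the derivative in the direction [y - p] vanishes, while coercivity
    bounds it below by [mu] times the squared distance. *)
Lemma coercive_isolated : \forall y \near p, local_minimizer f y -> y = p.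
Proof.
apply/nbhs_ballP; exists r => //= y; rewrite -ball_normE/= => py ymin.
have hr : `|y - p| <= r by rewrite distrC ltW.
have := coercive hr; rewrite subrKC (local_minimizer_derive (fun y => fdf y _) ymin).
rewrite pmulr_rle0// => e0; apply/eqP; rewrite -subr_eq0 -normr_le0.
apply: le_trans (ler_norm_enorm _) _.
by rewrite -(@ler_pXn2r _ 2) ?nnegrE ?enorm_ge0// expr0n.
Qed.

Lemma gradientE x : gradient f x = \matrix_(i, j) df x (delta_mx i j).
Proof. by apply/matrixP => i j; rewrite !mxE (@derive_val _ _ _ _ _ _ _ (fdf _ _)). Qed.

Lemma oppr_gradientE x i j : (- gradient f x) i j = - df x (delta_mx i j).
Proof. by rewrite gradientE !mxE. Qed.

Lemma gradient_flow_decrease x : enorm (x - p) < r ->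
  \sum_(i < m) \sum_(j < n) (x - p) i j * (- gradient f x) i j
    <= - mu * enorm (x - p) ^+ 2.
Proof.
move=> xr.
have -> : \sum_(i < m) \sum_(j < n) (x - p) i j * (- gradient f x) i j
    = - df x (x - p).
  rewrite df_coord -sumrN; apply: eq_bigr => i _; rewrite -sumrN.
  by apply: eq_bigr => j _; rewrite oppr_gradientE mulrN.
rewrite mulNr lerN2 -{2}[x](subrKC p); apply: coercive.
exact: le_trans (ler_norm_enorm _) (ltW xr).
Qed.

Lemma gradient_flow_decay x0 phi : enorm (x0 - p) < r ->
  gradient_flow_solution f x0 phi -> forall t : R, 0 <= t ->
  enorm (phi t - p) < r /\
  enorm (phi t - p) ^+ 2 <= r ^+ 2 * expR (- (2 * mu) * t).
Proof.
move=> x0r [phi0 cphi dphi].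
apply: (lyapunov_exp_decay r0 (ltW mu0) cphi dphi); last by rewrite phi0.
by move=> t t0; exact: gradient_flow_decrease.
Qed.

Lemma gradient_flow_cvg x0 phi : enorm (x0 - p) < r ->
  gradient_flow_solution f x0 phi -> phi t @[t --> +oo] --> p.
Proof.
move=> x0r sol; apply/cvgrPdist_lt => e e0.
have e20 : 0 < e ^+ 2 by rewrite exprn_gt0.
(* [T] satisfies [2 * mu * T = r^2 / e^2]; the bound [expR x >= 1 + x] then replaces a logarithm. *)
pose T := r ^+ 2 / e ^+ 2 / (2 * mu).
have T0 : 0 <= T by rewrite divr_ge0 ?divr_ge0 ?sqr_ge0// mulr_ge0// ltW.
exists T; split; first exact: num_real.
move=> t Tt; have t0 : 0 <= t by apply: (le_trans T0); exact: ltW.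
have [_ decay] := gradient_flow_decay x0r sol t0.
rewrite distrC (le_lt_trans (ler_norm_enorm _))//.
rewrite -(@ltr_pXn2r _ 2) ?nnegrE ?enorm_ge0 ?ltW//.
apply: (le_lt_trans decay); rewrite mulNr expRN ltr_pdivrMr ?expR_gt0//.
rewrite mulrC -ltr_pdivrMr//.
apply: lt_le_trans (expR_ge1Dx _).
apply: (@lt_trans _ _ (2 * mu * t)); last by rewrite ltrDr.
by move: Tt; rewrite /T ltr_pdivrMr ?mulr_gt0// (mulrC t).
Qed.

Lemma gradient_flow_exists x0 : enorm (x0 - p) < r ->
  exists phi : R -> 'M[R]_(m, n), gradient_flow_solution f x0 phi.
Proof.
move=> x0r.
have grad_lip : lipschitz_on_balls (fun x => - gradient f x).
  apply: lipschitz_on_balls_mx => i j.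
  have -> : (fun x => (- gradient f x) i j) = (fun x => - df x (delta_mx i j)).
    by apply/funext => x; exact: oppr_gradientE.
  exact: lipschitz_on_ballsN.
(* This radius covers the ball of radius [r] about [p], where the clamped field [H] equals the
   negative gradient. *)
have rho0 : 0 <= `|p| + r by rewrite addr_ge0// ltW.
have [H [L [M [L0 HL HM HE]]]] := lipschitz_extension rho0 grad_lip.
have [phi [phi0 dphi]] := picard_lindelof x0 L0 HL HM.
have HEp x : enorm (x - p) < r -> H x = - gradient f x.
  move=> xr; apply: HE; rewrite -[x](subrKC p) (le_trans (ler_normD _ _))// lerD2l.
  exact: le_trans (ler_norm_enorm _) (ltW xr).
have cphi : {within `[0, +oo[, continuous phi}.
  apply: continuous_in_subspaceT => t; rewrite inE/= in_itv/= andbT => t0.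
  exact: is_derive_continuous (dphi _ t0).
exists phi; split => // t t0.
rewrite -HEp; first by apply: dphi; exact: ltW.
(* The decrease condition is required only inside the ball, where both fields agree, so the estimate
   applies to the clamped flow and traps it there. *)
have [|||//] := @lyapunov_exp_decay _ _ _ phi (H \o phi) p r mu r0 (ltW mu0) cphi _ _ _ t (ltW t0).
- by move=> s s0; apply: dphi; exact: ltW.
- by move=> s s0 sr /=; rewrite HEp//; exact: gradient_flow_decrease.
- by rewrite phi0.
Qed.

End RadiallyCoercive.

(** * The energy of an infinitesimally rigid framework *)

(** [Q] attains a positive minimum on the compact unit sphere, and homogeneity carries it to all
    [h]. *)
Lemma coercive_of_homogeneous (R : realType) m n (Q : 'M[R]_(m, n) -> R) :
  continuous Q -> (forall (a : R) h, Q (a *: h) = a ^+ 2 * Q h) ->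
  (forall h, h != 0 -> 0 < Q h) ->
  exists2 lambda : R, 0 < lambda & forall h, lambda * `|h| ^+ 2 <= Q h.
Proof.
move=> cQ Qhom Qpos.
(* Compactness is used for row vectors, and [vec_mx] is an isometry for the sup norms. *)
have vec_norm (u : 'rV[R]_(m * n)) : `|vec_mx u| = `|u|.
  apply/eqP; rewrite eq_le; apply/andP; split; apply: mx_norm_le => // i j.
    by rewrite mxE; exact: ler_entry_norm.
  rewrite ord1; case/mxvec_indexP: j => i' j'.
  by have := ler_entry_norm (vec_mx u) i' j'; rewrite mxE.
have cvec : continuous (@vec_mx R m n).
  apply: (@lipschitz_continuous _ _ _ _ 1) => u v.
  by rewrite -linearB vec_norm mul1r.
pose S := [set u : 'rV[R]_(m * n) | `|u| = 1].
have Q0 : Q 0 = 0 by rewrite -(scale0r 0) Qhom expr0n mul0r.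
have normalize (h : 'M[R]_(m, n)) : h != 0 -> S (mxvec (`|h|^-1 *: h)).
  move=> h0; rewrite /S/= -vec_norm mxvecK normrZ ger0_norm ?invr_ge0//.
  by rewrite mulVf// normr_eq0.
(* The sphere is empty when [m * n = 0]; the only matrix is then 0 and any positive constant will
   do. *)
have [[u0 u0S]|S0] := pselect (S !=set0); last first.
  exists 1 => // h; have [->|h0] := eqVneq h 0.
    by rewrite Q0 normr0 expr0n mulr0.
  by case: S0; exists (mxvec (`|h|^-1 *: h)); exact: normalize.
have compS : compact S.
  apply: bounded_closed_compact.
    by exists 1; split => // M M1 u /= ->; exact: ltW.
  have -> : S = (fun u => `|u|) @^-1` [set 1] by [].
  apply: closed_comp => [u _|]; first exact: norm_continuous.
  exact: closed_eq.
have [|c cS cmin] := @EVT_min_rV R _ (Q \o vec_mx) S (ex_intro _ _ u0S) compS.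
  apply: continuous_subspaceT => u; apply: continuous_comp; [exact: cvec|exact: cQ].
have c1 : `|c| = 1 by move: cS; rewrite inE.
have cpos : 0 < Q (vec_mx c).
  by apply: Qpos; rewrite -normr_eq0 vec_norm c1 oner_eq0.
exists (Q (vec_mx c)) => // h; have [->|h0] := eqVneq h 0.
  by rewrite Q0 normr0 expr0n mulr0.
have := cmin (mxvec (`|h|^-1 *: h)); rewrite inE => /(_ (normalize _ h0)).
rewrite /= mxvecK Qhom exprVn ler_pdivlMl 1?mulrC//.
by rewrite exprn_gt0// normr_gt0.
Qed.

Lemma is_derive_coord (R : realType) m n (x v : 'M[R]_(m, n)) i j :
  is_derive x v (fun y : 'M[R]_(m, n) => y i j) (v i j).
Proof. by have /is_derive_mxP := is_derive_id x v. Qed.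

(** * Linear forms on matrices *)

Section ScalarForms.
Variables (R : realType) (U : lmodType R).

Lemma scalar_sum (I : Type) (s : seq I) (P : pred I) (g : I -> U -> R) :
  (forall i, scalar (g i)) -> scalar (fun v => \sum_(i <- s | P i) g i v).
Proof.
move=> gl a u v; rewrite mulr_sumr -big_split /=.
by apply: eq_bigr => i _; exact: gl.
Qed.

Lemma scalarD (g h : U -> R) : scalar g -> scalar h -> scalar (fun v => g v + h v).
Proof. by move=> gl hl a u v; rewrite gl hl mulrDr addrACA. Qed.

Lemma scalarB (g h : U -> R) : scalar g -> scalar h -> scalar (fun v => g v - h v).
Proof. by move=> gl hl a u v; rewrite gl hl mulrBr opprD addrACA. Qed.

Lemma scalarZ (c : R) (g : U -> R) : scalar g -> scalar (fun v => c * g v).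
Proof. by move=> gl a u v; rewrite gl mulrDr mulrCA. Qed.

End ScalarForms.

Lemma scalar_coord (R : realType) m n (i : 'I_m) (j : 'I_n) :
  scalar (fun v : 'M[R]_(m, n) => v i j).
Proof. by move=> a u v; rewrite !mxE. Qed.

Lemma scalar_mxE (R : realType) m n (g : 'M[R]_(m, n) -> R) (v : 'M[R]_(m, n)) :
  scalar g -> g v = \sum_(i < m) \sum_(j < n) v i j * g (delta_mx i j).
Proof.
move=> gl.
have gD x y : g (x + y) = g x + g y by have := gl 1 x y; rewrite scale1r mul1r.
have g0 : g 0 = 0 by have := gD 0 0; rewrite addr0; lra.
rewrite {1}[v]matrix_sum_delta (big_morph g gD g0).
apply: eq_bigr => i _; rewrite (big_morph g gD g0); apply: eq_bigr => j _.
by have := gl (v i j) (delta_mx i j) 0; rewrite g0 !addr0.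
Qed.

Lemma enorm_rV_sqr (R : realType) n (v : 'rV[R]_n) :
  enorm v ^+ 2 = \sum_(k < n) v 0 k ^+ 2.
Proof. by rewrite enorm_sqr big_ord1. Qed.

Lemma dotvE (R : realType) n (u v : 'rV[R]_n) : dotv u v = \sum_(k < n) u 0 k * v 0 k.
Proof. by rewrite /dotv mxE; apply: eq_bigr => k _; rewrite mxE. Qed.

(** * Cross product in three-dimensional space *)

Lemma ord3P (i : 'I_3) : [\/ i = 0, i = 1 | i = 2].
Proof.
by case: i => -[|[|[|//]]] ?; [apply: Or31|apply: Or32|apply: Or33]; apply/val_inj.
Qed.

(** The entries of the cross product are, up to sign, the 2x2 minors of the pair, so
    [w i * a j = w j * a i] for all indices; dividing by a nonzero entry [w k] gives the factor
    [a k / w k]. *)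
Lemma cross_eq0_collinear (R : realType) (w a : 'rV[R]_3) :
  w != 0 -> cross w a = 0 -> exists t, a = t *: w.
Proof.
move=> w0 cr.
have H k : w 0 (k + 1) * a 0 (k + 2) = w 0 (k + 2) * a 0 (k + 1).
  by have /matrixP/(_ 0 k) := cr; rewrite !mxE => /eqP; rewrite subr_eq0 => /eqP.
have e12 : (1 + 2 : 'I_3) = 0 by apply/val_inj.
have e21 : (2 + 1 : 'I_3) = 0 by apply/val_inj.
have e22 : (2 + 2 : 'I_3) = 1 by apply/val_inj.
have e11 : (1 + 1 : 'I_3) = 2 by apply/val_inj.
have := H 0; have := H 1; have := H 2; rewrite !add0r e12 e21 e22 e11 => h2 h1 h0.
have {}H i j : w 0 i * a 0 j = w 0 j * a 0 i.
  by case: (ord3P i) => ->; case: (ord3P j) => ->.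
have [k wk] : exists k, w 0 k != 0.
  apply/existsP; rewrite -negb_forall; apply: contra w0 => /forallP wz.
  by apply/eqP/rowP => k; rewrite mxE; exact/eqP/wz.
exists (a 0 k / w 0 k); apply/rowP => j; rewrite mxE.
apply: (mulIf wk); rewrite -[RHS]mulrA (mulrC (w 0 j)) mulrA divfK//.
by rewrite mulrC H mulrC.
Qed.

Lemma crossB (R : realType) (w a b : 'rV[R]_3) : cross w (a - b) = cross w a - cross w b.
Proof. by apply/rowP => k; rewrite !mxE; ring. Qed.

Lemma cross0l (R : realType) (a : 'rV[R]_3) : cross 0 a = 0.
Proof. by apply/rowP => k; rewrite !mxE; ring. Qed.

(** * Derivative and coercivity of the energy *)

Section Energy.
Variables (R : realType) (n : nat) (E : rel 'I_n) (p : 'I_n -> 'rV[R]_3).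
Variables (ic iota kappa : 'I_n).
Implicit Types x v h : 'M[R]_(n, 3).

Local Notation edge i j := ((i < j)%N && E i j).
Local Notation e := (energy E p ic iota kappa).
Local Notation pstar := (true_values p ic).

Definition energy_derivative x v : R :=
  \sum_(i < n) \sum_(j < n | edge i j)
     (\sum_k (x j k - x i k) ^+ 2 - enorm (p j - p i) ^+ 2) *
     (\sum_k (x j k - x i k) * (v j k - v i k))
  + \sum_k x ic k * v ic k
  + \sum_k (x iota k - (p iota - p ic) 0 k) * v iota k
  + \sum_k (x kappa k - (p kappa - p ic) 0 k) * v kappa k.

Lemma energyE x : e x =
  4^-1 * (\sum_(i < n) \sum_(j < n | edge i j)
     (\sum_k (x j k - x i k) ^+ 2 - enorm (p j - p i) ^+ 2) ^+ 2)
  + 2^-1 * (\sum_k x ic k ^+ 2)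
  + 2^-1 * (\sum_k (x iota k - (p iota - p ic) 0 k) ^+ 2)
  + 2^-1 * (\sum_k (x kappa k - (p kappa - p ic) 0 k) ^+ 2).
Proof.
rewrite /energy !enorm_rV_sqr; congr (_ * _ + _ * _ + _ * _ + _ * _).
- apply: eq_bigr => i _; apply: eq_bigr => j _; congr ((_ - _) ^+ 2).
  by rewrite enorm_rV_sqr; apply: eq_bigr => k _; rewrite !mxE.
- by apply: eq_bigr => k _; rewrite !mxE.
- by apply: eq_bigr => k _; rewrite !mxE.
- by apply: eq_bigr => k _; rewrite !mxE.
Qed.

Lemma is_derive_energy x v : is_derive x v e (energy_derivative x v).
Proof.
rewrite (funext energyE).
have dsq (V : normedModType R) (f : V -> R) (y u : V) (df : R) :
    is_derive y u f df -> is_derive y u (fun z => f z ^+ 2) (2 * (f y * df)).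
  move=> fdf; apply: (is_derive_eq (is_deriveM fdf fdf)).
  by rewrite /GRing.scale/=; ring.
have dC (f : 'M[R]_(n, 3) -> R) (c df : R) :
    is_derive x v f df -> is_derive x v (fun z => f z - c) df.
  by move=> fdf; rewrite -[df]subr0; exact: is_deriveB.
have dD (f g : 'M[R]_(n, 3) -> R) (a b : R) :
    is_derive x v f a -> is_derive x v g b -> is_derive x v (fun z => f z + g z) (a + b).
  by move=> fa gb; exact: is_deriveD.
have dpin i (c : 'rV[R]_3) :
    is_derive x v (fun y : 'M[R]_(n, 3) => 2^-1 * \sum_k (y i k - c 0 k) ^+ 2)
      (\sum_k (x i k - c 0 k) * v i k).
  have -> : \sum_k (x i k - c 0 k) * v i k =
      2^-1 *: \sum_k 2 * ((x i k - c 0 k) * v i k).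
    by rewrite /GRing.scale/= -mulr_sumr mulrA mulVf// mul1r.
  apply: is_deriveZ; apply: is_derive_bigsum => k; apply: (dsq); apply: (dC).
  exact: is_derive_coord.
refine (dD _ _ _ _ _ (dpin _ _)).
refine (dD _ _ _ _ _ (dpin _ _)).
refine (dD _ _ _ _ _ _).
  (* The inner and outer squares each contribute a factor 2, which together cancel the coefficient
     1/4. *)
  have -> : \sum_(i < n) \sum_(j < n | edge i j)
     (\sum_k (x j k - x i k) ^+ 2 - enorm (p j - p i) ^+ 2) *
     (\sum_k (x j k - x i k) * (v j k - v i k)) =
     4^-1 *: \sum_(i < n) \sum_(j < n | edge i j)
     2 * ((\sum_k (x j k - x i k) ^+ 2 - enorm (p j - p i) ^+ 2) *
     (\sum_k 2 * ((x j k - x i k) * (v j k - v i k)))).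
    rewrite /GRing.scale/= mulr_sumr; apply: eq_bigr => i _.
    rewrite mulr_sumr; apply: eq_bigr => j _; rewrite -mulr_sumr.
    by field.
  apply: is_deriveZ; apply: is_derive_bigsum => i; apply: is_derive_bigsum => j.
  apply: (dsq); apply: (dC); apply: is_derive_bigsum => k; apply: (dsq).
  by apply: is_deriveB; exact: is_derive_coord.
(* The vertex [ic] is pinned to the origin: the case [c = 0] of [dpin]. *)
have := dpin ic 0.
rewrite (_ : (fun y : 'M[R]_(n, 3) => _) = (fun y => 2^-1 * \sum_k y ic k ^+ 2)).
  by under eq_bigr do rewrite mxE subr0.
by apply/funext => y; congr (_ * _); apply: eq_bigr => k _; rewrite mxE subr0.
Qed.

Lemma scalar_energy_derivative x : scalar (energy_derivative x).
Proof.
do ![apply: scalarD].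
- apply: scalar_sum => i; apply: scalar_sum => j; apply: scalarZ.
  by apply: scalar_sum => k; apply: scalarZ; apply: scalarB; exact: scalar_coord.
- by apply: scalar_sum => k; apply: scalarZ; exact: scalar_coord.
- by apply: scalar_sum => k; apply: scalarZ; exact: scalar_coord.
- by apply: scalar_sum => k; apply: scalarZ; exact: scalar_coord.
Qed.

Lemma lipschitz_on_balls_energy_derivative v :
  lipschitz_on_balls (energy_derivative ^~ v).
Proof.
have xB i j k : lipschitz_on_balls (fun x : 'M[R]_(n, 3) => x j k - x i k).
  by apply: lipschitz_on_ballsB; exact: lipschitz_on_balls_coord.
have lpin i (c : 'rV[R]_3) : lipschitz_on_balls
    (fun x : 'M[R]_(n, 3) => \sum_k (x i k - c 0 k) * v i k).
  apply: lipschitz_on_balls_sum => k; apply: lipschitz_on_ballsM;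
    last exact: lipschitz_on_balls_cst.
  apply: lipschitz_on_ballsB; [exact: lipschitz_on_balls_coord|exact: lipschitz_on_balls_cst].
do ![apply: lipschitz_on_ballsD]; last 2 first.
- exact: lpin.
- exact: lpin.
- apply: lipschitz_on_balls_sum => i; apply: lipschitz_on_balls_sum => j.
  apply: lipschitz_on_ballsM.
    apply: lipschitz_on_ballsB; last exact: lipschitz_on_balls_cst.
    by apply: lipschitz_on_balls_sum => k; exact: lipschitz_on_ballsX.
  apply: lipschitz_on_balls_sum => k; apply: lipschitz_on_ballsM => //.
  exact: lipschitz_on_balls_cst.
- apply: lipschitz_on_balls_sum => k; apply: lipschitz_on_ballsM.
    exact: lipschitz_on_balls_coord.
  exact: lipschitz_on_balls_cst.
Qed.

(** The row of the rigidity matrix for the edge, applied to [h]: the first-order change of half the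
    squared length. *)
Definition stretch h (i j : 'I_n) : R := \sum_k (p j 0 k - p i 0 k) * (h j k - h i k).

(** The Hessian form of the energy at the true values has twice the stretch term; one copy is given
    up to absorb the higher-order terms. *)
Definition stiffness h : R :=
  \sum_(i < n) \sum_(j < n | edge i j) stretch h i j ^+ 2
  + \sum_k h ic k ^+ 2 + \sum_k h iota k ^+ 2 + \sum_k h kappa k ^+ 2.

Definition dist2 h (i j : 'I_n) : R := \sum_k (h j k - h i k) ^+ 2.

(** For an edge with stretch s and [dist2] equal to d, the squared length exceeds its target by 2s +
    d, and the inner product of the displaced edge with its displacement is s + d. The pins give
    exact squares because the true values satisfy them. *)
Lemma energy_derivative_radial h : energy_derivative (pstar + h) h =
  \sum_(i < n) \sum_(j < n | edge i j)
    (2 * stretch h i j + dist2 h i j) * (stretch h i j + dist2 h i j)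
  + \sum_k h ic k ^+ 2 + \sum_k h iota k ^+ 2 + \sum_k h kappa k ^+ 2.
Proof.
rewrite /energy_derivative; congr (_ + _ + _ + _).
- apply: eq_bigr => i _; apply: eq_bigr => j _; congr (_ * _).
    rewrite enorm_rV_sqr -sumrB /stretch /dist2 mulr_sumr -big_split /=.
    by apply: eq_bigr => k _; rewrite !mxE; ring.
  rewrite /stretch /dist2 -big_split /=.
  by apply: eq_bigr => k _; rewrite !mxE; ring.
- by apply: eq_bigr => k _; rewrite !mxE; ring.
- by apply: eq_bigr => k _; rewrite !mxE; ring.
- by apply: eq_bigr => k _; rewrite !mxE; ring.
Qed.

Lemma stiffness_le_radial : exists2 C : R, 0 <= C &
  forall h, stiffness h - C * `|h| ^+ 4 <= energy_derivative (pstar + h) h.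
Proof.
(* Each of the 3 entries of a difference of rows is at most [2 * |h|], so [dist2] is at most 12
   |h|^2; then 180 = 5/4 * 12^2, and the sum counts the edges. *)
exists (180 * \sum_(i < n) \sum_(j < n | edge i j) 1) => [|h].
  by rewrite mulr_ge0// sumr_ge0// => i _; rewrite sumr_ge0.
rewrite energy_derivative_radial /stiffness.
suff H : \sum_(i < n) \sum_(j < n | edge i j) stretch h i j ^+ 2
    - (180 * \sum_(i < n) \sum_(j < n | edge i j) 1) * `|h| ^+ 4
    <= \sum_(i < n) \sum_(j < n | edge i j)
    (2 * stretch h i j + dist2 h i j) * (stretch h i j + dist2 h i j).
  by move: H; lra.
rewrite -mulrA mulrC -mulrA mulr_suml -sumrB; apply: ler_sum => i _.
rewrite mulr_suml -sumrB; apply: ler_sum => j _; rewrite mul1r.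
have d0 : 0 <= dist2 h i j by apply: sumr_ge0 => k _; exact: sqr_ge0.
have dle : dist2 h i j <= 12 * `|h| ^+ 2.
  apply: (@le_trans _ _ (\sum_(k < 3) 4 * `|h| ^+ 2)).
    apply: ler_sum => k _.
    have hle : `|h j k - h i k| <= 2 * `|h|.
      rewrite mulr2n mulrDl mul1r (le_trans (ler_normB _ _))//.
      by apply: lerD; exact: ler_entry_norm.
    rewrite -real_normK ?num_real//.
    apply: (@le_trans _ _ ((2 * `|h|) ^+ 2)); first by rewrite lerXn2r ?nnegrE ?mulr_ge0.
    by rewrite exprMn -natrX.
  by rewrite sumr_const card_ord -mulr_natl; lra.
have dsq : dist2 h i j ^+ 2 <= 144 * `|h| ^+ 4.
  have -> : 144 * `|h| ^+ 4 = (12 * `|h| ^+ 2) ^+ 2 by ring.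
  by rewrite lerXn2r ?nnegrE// mulr_ge0// sqr_ge0.
(* With a the stretch and b the squared distance:
   (2a + b)(a + b) = a^2 - 5/4 b^2 + (a + 3/2 b)^2. *)
have := sqr_ge0 (stretch h i j + 3 / 2 * dist2 h i j).
by move: (stretch _ _ _) (dist2 _ _ _) (`|h| ^+ 4) dsq => s d q; nra.
Qed.

Lemma continuous_stiffness : continuous stiffness.
Proof.
apply: lipschitz_on_balls_continuous; rewrite /stiffness.
have xX i : lipschitz_on_balls (fun x : 'M[R]_(n, 3) => \sum_k x i k ^+ 2).
  apply: lipschitz_on_balls_sum => k; apply: lipschitz_on_ballsX.
  exact: lipschitz_on_balls_coord.
do ![apply: lipschitz_on_ballsD => //].
apply: lipschitz_on_balls_sum => i; apply: lipschitz_on_balls_sum => j.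
apply: lipschitz_on_ballsX; apply: lipschitz_on_balls_sum => k.
apply: lipschitz_on_ballsM; first exact: lipschitz_on_balls_cst.
by apply: lipschitz_on_ballsB; exact: lipschitz_on_balls_coord.
Qed.

Lemma stiffnessZ (a : R) h : stiffness (a *: h) = a ^+ 2 * stiffness h.
Proof.
have sqZ i : \sum_k (a *: h) i k ^+ 2 = a ^+ 2 * \sum_k h i k ^+ 2.
  by rewrite mulr_sumr; apply: eq_bigr => k _; rewrite mxE exprMn.
rewrite /stiffness !mulrDr !sqZ; congr (_ + _ + _ + _).
rewrite mulr_sumr; apply: eq_bigr => i _; rewrite mulr_sumr; apply: eq_bigr => j _.
rewrite -exprMn /stretch mulr_sumr; congr (_ ^+ 2).
by apply: eq_bigr => k _; rewrite !mxE; ring.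
Qed.

Hypotheses (E_sym : symmetric E) (E_irr : irreflexive E).
Hypothesis rigid : infinitesimally_rigid E p.
Hypothesis noncollinear : ~ collinear3 (p ic) (p iota) (p kappa).

Lemma stiffness_gt0 h : h != 0 -> 0 < stiffness h.
Proof.
apply: contraNT; rewrite -leNgt => Qle0.
have sq0 i : 0 <= \sum_k h i k ^+ 2 by apply: sumr_ge0 => k _; exact: sqr_ge0.
have st0 (i : 'I_n) : 0 <= \sum_(j < n | edge i j) stretch h i j ^+ 2.
  by apply: sumr_ge0 => j _; exact: sqr_ge0.
have sum0 : 0 <= \sum_(i < n) \sum_(j < n | edge i j) stretch h i j ^+ 2.
  by apply: sumr_ge0 => i _; exact: st0.
have row0 i : \sum_k h i k ^+ 2 <= 0 -> row i h = 0.
  move=> le0; apply/rowP => k; rewrite !mxE; apply/eqP; rewrite -sqrf_eq0.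
  apply/eqP; move: k (erefl true); apply: psumr_eq0P => [k _|]; first exact: sqr_ge0.
  by apply/eqP; rewrite eq_le le0 sq0.
have := sq0 ic; have := sq0 iota; have := sq0 kappa => hk hi hc.
have ric : row ic h = 0 by apply: row0; move: Qle0; rewrite /stiffness; lra.
have riota : row iota h = 0 by apply: row0; move: Qle0; rewrite /stiffness; lra.
have rkappa : row kappa h = 0 by apply: row0; move: Qle0; rewrite /stiffness; lra.
have str0 (i j : 'I_n) : edge i j -> stretch h i j = 0.
  move=> eij; apply/eqP; rewrite -sqrf_eq0; apply/eqP.
  move: j eij; apply: psumr_eq0P => [j _|]; first exact: sqr_ge0.
  move: i (erefl true); apply: psumr_eq0P => [i _|]; first exact: st0.
  by apply/eqP; rewrite eq_le sum0 andbT; move: Qle0; rewrite /stiffness; lra.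
have str_sym (i j : 'I_n) : stretch h i j = stretch h j i.
  by apply: eq_bigr => k _; ring.
(* Read row by row, [h] is a velocity assignment. Edges are summed with the smaller index first, so
   the other orientation uses the symmetry of [E] and of [stretch]. *)
have [w [c hE]] : exists w c : 'rV[R]_3, forall u, row u h = cross w (p u) + c.
  apply: rigid => u v Euv.
  have -> : dotv (row u h - row v h) (p u - p v) = stretch h v u.
    by rewrite dotvE; apply: eq_bigr => k _; rewrite !mxE mulrC.
  have [uv|vu|/val_inj uv] := ltngtP u v.
  - by rewrite str_sym; apply: str0; rewrite uv.
  - by apply: str0; rewrite vu E_sym.
  - by rewrite uv E_irr in Euv.
(* Both [i] and [ic] have zero velocity, so subtraction eliminates [c]. *)
have par i : row i h = 0 -> cross w (p i - p ic) = 0.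
  by move=> ri; apply/eqP; rewrite crossB subr_eq0 -(inj_eq (addIr c)) -!hE ri ric.
have w0 : w = 0.
  (* Both differences would be multiples of a nonzero [w], placing the three points on the line
     through [p ic] of direction [w]. *)
  apply/eqP/negPn/negP => w0; apply: noncollinear.
  have [s sE] := cross_eq0_collinear w0 (par _ riota).
  have [t tE] := cross_eq0_collinear w0 (par _ rkappa).
  exists (p ic), w; split=> //; exists 0, s, t.
  by rewrite scale0r addr0 -sE -tE !subrKC.
have c0 : c = 0 by have := hE ic; rewrite ric w0 cross0l add0r.
apply/eqP/row_matrixP => i; rewrite hE w0 c0 cross0l addr0.
by apply/rowP => k; rewrite !mxE.
Qed.

Lemma energy_coercive : exists r mu : R, [/\ 0 < r, 0 < mu &
  forall h, `|h| <= r -> mu * enorm h ^+ 2 <= energy_derivative (pstar + h) h].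
Proof.
have [l l0 lQ] := coercive_of_homogeneous continuous_stiffness stiffnessZ stiffness_gt0.
have [C C0 CQ] := stiffness_le_radial.
pose D := (n * 3)%:R + 1 : R.
have D0 : 0 < D by rewrite ltr_wpDl.
(* For [|h| <= 1] the quartic loss is at most [C * |h|^3], and the second bound on the radius makes
   it at most half of [l * |h|^2]. The other half, divided by [D], survives the passage to the
   Euclidean norm. The summands 1 in [C + 1] and [D] keep the denominators positive. *)
exists (Num.min 1 (l / (2 * (C + 1)))), (l / (2 * D)); split.
- by rewrite lt_min ltr01 divr_gt0// mulr_gt0// ltr_wpDl.
- by rewrite divr_gt0// mulr_gt0.
move=> h; rewrite le_min => /andP[h1 hl].
apply: le_trans (CQ h); apply: (@le_trans _ _ (l / 2 * `|h| ^+ 2)).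
  have -> : l / 2 * `|h| ^+ 2 = l / (2 * D) * (D * `|h| ^+ 2).
    by field; rewrite gt_eqF.
  rewrite ler_wpM2l//; first by rewrite divr_ge0// ltW// mulr_gt0.
  apply: (le_trans (enorm_sqr_le h)); rewrite ler_wpM2r ?sqr_ge0//.
  by rewrite /D lerDl.
have Ch : C * `|h| ^+ 2 <= l / 2.
  move: hl; rewrite ler_pdivlMr ?mulr_gt0 ?ltr_wpDl// => hl.
  have := normr_ge0 h; move: (`|h|) h1 hl => y; nra.
have := lQ h; have := ler_wpM2r (sqr_ge0 `|h|) Ch.
have -> : `|h| ^+ 4 = `|h| ^+ 2 * `|h| ^+ 2 by rewrite -exprD.
by move: (`|h| ^+ 2) => q; lra.
Qed.

Lemma energy_ge0 x : 0 <= e x.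
Proof.
rewrite energyE !addr_ge0// ?mulr_ge0// ?sumr_ge0// => [i _|? _|? _|? _]; try exact: sqr_ge0.
by rewrite sumr_ge0// => j _; exact: sqr_ge0.
Qed.

Lemma energy_true_values : e pstar = 0.
Proof.
rewrite energyE [X in 4^-1 * X]big1 => [|i _]; last first.
  apply: big1 => j _; rewrite enorm_rV_sqr -sumrB big1 ?expr0n// => k _.
  by rewrite !mxE; ring.
rewrite !big1 ?mulr0 ?addr0// => k _; rewrite !mxE; ring.
Qed.

End Energy.

Theorem mainTheorem2 (R : realType) (n : nat) (E : rel 'I_n)
    (E_sym : symmetric E) (E_irr : irreflexive E)
    (p : 'I_n -> 'rV[R]_3)
    (rigid : infinitesimally_rigid E p)
    (ic iota kappa : 'I_n)
    (ic_iota : E ic iota) (ic_kappa : E ic kappa)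
    (noncollinear : ~ collinear3 (p ic) (p iota) (p kappa)) :
  let e := energy E p ic iota kappa in
  let pstar := true_values p ic in
  isolated_local_minimizer e pstar /\
  exists2 eps : R, 0 < eps &
    forall x0 : 'M[R]_(n, 3), enorm (x0 - pstar) < eps ->
      (exists phi : R -> 'M[R]_(n, 3), gradient_flow_solution e x0 phi) /\
      (forall phi : R -> 'M[R]_(n, 3), gradient_flow_solution e x0 phi ->
         phi t @[t --> +oo] --> pstar).
Proof.
move=> /=.
have [r [mu [r0 mu0 coercive]]] := energy_coercive E_sym E_irr rigid noncollinear.
have de := is_derive_energy E p ic iota kappa.
have de_coord x v := scalar_mxE v (scalar_energy_derivative E p ic iota kappa x).
have de_lip := lipschitz_on_balls_energy_derivative E p ic iota kappa.
split; first split.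
(* The energy is nonnegative and zero at the true values, so the minimum is global and the radius 1
   is arbitrary. *)
- apply/nbhs_ballP; exists 1 => //= y _.
  by rewrite energy_true_values energy_ge0.
- exact: coercive_isolated r0 mu0 de coercive.
exists r => // x0 x0r; split.
- exact: (gradient_flow_exists r0 mu0 de de_coord de_lip coercive x0r).
- by move=> phi; exact: (gradient_flow_cvg r0 mu0 de de_coord coercive x0r).
Qed.
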